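(* Let $\mathcal{A}:\mathcal{B}_1\to\mathcal{B}_2$ be a continuous non-linear map between two Banach spaces, and let $f_0\in\mathcal{B}_1$. Assume that the differential $A_{f_0}$ of $\mathcal{A}$ at $f_0$ exists and that $$\mathcal{A}(f)=\mathcal{A}(f_0)+A_{f_0}(f-f_0)+R_{f_0}(f),\qquad \|R_{f_0}(f)\|_{\mathcal{B}_2}\le C_{f_0}\|f-f_0\|_{\mathcal{B}_1}^2, \tag{i}$$ for $f$ in some neighborhood of $f_0$ in $\mathcal{B}_1$. Assume also that, with some Banach spaces $\mathcal{B}_1'\supset\mathcal{B}_1$ and $\mathcal{B}_2'\subset\mathcal{B}_2$, $$\|h\|_{\mathcal{B}_1'}\le C\|A_{f_0}h\|_{\mathcal{B}_2'},\qquad \forall h\in\mathcal{B}_1. \tag{ii}$$ Assume also that there exist Banach spaces $\mathcal{B}_2''\subset\mathcal{B}_2'$, $\mathcal{B}_1''\subset\mathcal{B}_1$ so that $A_{f_0}$ continuously maps $\mathcal{B}_1''$ into $\mathcal{B}_2''$ and the following interpolation estimates hold: $$\|u\|_{\mathcal{B}_2'}\le C\|u\|_{\mathcal{B}_2}^{\mu_2}\|u\|_{\mathcal{B}_2''}^{1-\mu_2},\qquad \|h\|_{\mathcal{B}_1}\le C\|h\|_{\mathcal{B}_1'}^{\mu_1}\|h\|_{\mathcal{B}_1''}^{1-\mu_1},\qquad \mu_1,\mu_2\in(0,1],\quad \mu_1\mu_2>1/2.$$ (a) For any $K>0$ there exists $\epsilon>0$ so that for any $f$ with $$\|f-f_0\|_{\mathcal{B}_1}\le\epsilon,\qquad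 \|f\|_{\mathcal{B}_1''}\le K,$$ one has the conditional stability estimate $$\|f-f_0\|_{\mathcal{B}_1}\le C(K)\,\|\mathcal{A}(f)-\mathcal{A}(f_0)\|_{\mathcal{B}_2}^{\mu_1\mu_2},\qquad C(K)=CK^{2-\mu_1-\mu_2}.$$ In particular, there is weak local uniqueness near $f_0$, i.e., if $\mathcal{A}(f)=\mathcal{A}(f_0)$ for such an $f$, then $f=f_0$. (b) Assume in addition that there is a Banach space $\mathcal{K}\subset\mathcal{B}_1''$ so that (ii) holds with $f_0$ replaced by $f$ for all $f$ close enough to $f_0$ in $\mathcal{K}$, and $A_f:\mathcal{B}_1''\to\mathcal{B}_2''$ is uniformly bounded for such $f$. Then there exists $\epsilon>0$ so that for any $f_1,f_2$ with $$\|f_1-f_0\|_{\mathcal{K}}\le\epsilon,\qquad \|f_2-f_0\|_{\mathcal{K}}\le\epsilon,$$ one has the conditional stability estimate $$\|f_1-f_2\|_{\mathcal{B}_1}\le C\,\|\mathcal{A}(f_1)-\mathcal{A}(f_2)\|_{\mathcal{B}_2}^{\mu_1\mu_2}.$$ In particular, there is strong local uniqueness near $f_0$, i.e., if $\mathcal{A}(f_1)=\mathcal{A}(f_2)$ for such $f_1,f_2$, then $f_1=f_2$.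
   Context: An inclusion $X\subset Y$ of Banach spaces also means that $\|\cdot\|_Y\le C\|\cdot\|_X$ on $X$. $A_f$ denotes the differential of $\mathcal{A}$ at $f$. The letter $C$ denotes positive constants that may differ from one estimate to another. The estimates are called conditional because $f$ (respectively $f_1,f_2$) is restricted by a norm stronger than the one on the left-hand side.
   Formalization: In (a) the constant C in C(K)=CK^{2-μ1-μ2} is uniform only for K≥K0, with K0>0 arbitrary (one C for all K fails at f0=0); in (b) the quadratic remainder bound (i) is also assumed, uniformly, for pairs f,g close to f0 in 𝒦, without which (b) fails. *)

(* Defs.v *)
From HB Require Import structures.
From mathcomp Require Import all_boot all_order all_algebra.
From mathcomp Require Import all_classical all_reals all_analysis.

Set Implicit Arguments.
Unset Strict Implicit.
Unset Printing Implicit Defensive.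

Import Order.TTheory GRing.Theory Num.Theory.
Import numFieldNormedType.Exports.

Local Open Scope classical_set_scope.
Local Open Scope ring_scope.

(* Banach spaces are [completeNormedModType R] with [R : realType].  Different
   norms need different types, so X ⊂ Y is given by an explicit linear map
   i : X -> Y, and "u, seen as an element of Y" is written [i u].  A norm of the
   smaller space is only ever applied to elements of the smaller type. *)
Definition banach_inclusion (R : realType) (X Y : completeNormedModType R)
    (i : {linear X -> Y}) : Prop :=
  injective i /\ exists2 C : R, 0 < C & forall x : X, `|i x| <= C * `|x|.

Definition remainder (R : realType) (X Y : completeNormedModType R)
    (A : X -> Y) (f0 f : X) : Y :=
  A f - (A f0 + 'd A f0 (f - f0)).

(* ‖h‖_{B1'} <= C ‖L h‖_{B2'} for all h in B1, where j1 : B1 ⊂ B1' and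
   i2 : B2' ⊂ B2.  If L h is not in B2' its B2'-norm is +oo and nothing is
   asserted; otherwise L h = i2 v for a unique v. *)
Definition linear_stability (R : realType)
    (B1 B1' B2 B2' : completeNormedModType R)
    (j1 : B1 -> B1') (i2 : B2' -> B2) (C : R) (L : B1 -> B2) : Prop :=
  forall (h : B1) (v : B2'), i2 v = L h -> `|j1 h| <= C * `|v|.

(* ‖u‖_Y <= C ‖u‖_Z^mu ‖u‖_X^(1 - mu) for u in X, where i : X ⊂ Y and
   j : Y ⊂ Z.  With 0 < mu <= 1 the convention 0 `^ 0 = 1 is harmless: for
   u = 0 both sides vanish. *)
Definition interpolation_estimate (R : realType)
    (X Y Z : completeNormedModType R) (i : X -> Y) (j : Y -> Z) (mu : R) : Prop :=
  exists2 C : R, 0 < C &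
    forall u : X, `|i u| <= C * `|j (i u)| `^ mu * `|u| `^ (1 - mu).

(* T : X1 -> X2 is the restriction of L : Y1 -> Y2, where i1 : X1 ⊂ Y1 and
   i2 : X2 ⊂ Y2. *)
Definition restricts_to (X1 Y1 X2 Y2 : Type)
    (i1 : X1 -> Y1) (i2 : X2 -> Y2) (L : Y1 -> Y2) (T : X1 -> X2) : Prop :=
  forall h : X1, i2 (T h) = L (i1 h).

(* ‖f - f0‖_X <= r for f, f0 in Y, where i : X ⊂ Y.  This requires f - f0 to be
   in X, but not f0 itself; if f0 is in X then so is f. *)
Definition close_in (R : realType) (X Y : completeNormedModType R)
    (i : X -> Y) (f0 : Y) (r : R) (f : Y) : Prop :=
  exists2 k : X, f - f0 = i k & `|k| <= r.

(* Main.v *)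
Require Import Defs.
From HB Require Import structures.
From mathcomp Require Import all_boot all_order all_algebra.
From mathcomp Require Import all_classical all_reals all_analysis.
From mathcomp Require Import ring lra.

Set Implicit Arguments.
Unset Strict Implicit.
Unset Printing Implicit Defensive.

Import Order.TTheory GRing.Theory Num.Theory.
Import numFieldNormedType.Exports.

Local Open Scope classical_set_scope.
Local Open Scope ring_scope.

(** Write [h = f - f0].  Interpolating between [B1''] and [B1'], then using the
    linear stability estimate (ii), then interpolating between [B2''] and [B2],
    one gets [|h| <= C * K `^ (1 - m) * |A_f0 h| `^ m] with [m = mu1 * mu2].
    By (i), [|A_f0 h|] is at most [|A f - A f0| + C * |h| ^+ 2], and since
    [2 * m > 1] the quadratic term is absorbed when [|h|] is small.  The stated
    exponent differs from this one by
    [(2 - mu1 - mu2) - (1 - m) = (1 - mu1) * (1 - mu2) >= 0], which is why the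
    constant depends on the lower bound [K0] of [K].
    In (a), [f0] is not assumed to lie in [B1'']: unless (a) is void for small
    [eps], [f0] is a limit in [B1] of elements of the [K]-ball of [B1''], and
    the interpolation estimates pass to such limits. *)

(** * Real powers: a limit and the absorption of a quadratic term *)

(** Right continuity of the power at [x]. It serves when the quantity under the power is only known
    to be eventually below each [t > x]. *)
Lemma ler_powR_lim (R : realType) (a p x y : R) : 0 <= a -> 0 < p -> 0 <= x ->
  (forall t, x < t -> y <= a * t `^ p) -> y <= a * x `^ p.
Proof.
move=> a0 p0 x0 yt; apply/ler_addgt0Pr => e e0.
have a1 : 0 < a + 1 by lra.
(* The test value [t] has [p]-th power [s]; dividing by [a + 1] covers [a = 0], and
   [a * (e / (a + 1)) <= e]. *)
pose s := x `^ p + e / (a + 1).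
have e'0 : 0 < e / (a + 1) by rewrite divr_gt0.
have s0 : 0 < s by rewrite ltr_wpDl ?powR_ge0.
have sK : (s `^ p^-1) `^ p = s by rewrite -powRrM mulVf ?gt_eqF// powRr1// ltW.
have xs : x < s `^ p^-1.
  rewrite -[ltLHS](@powRr1 R)// -[X in x `^ X](mulfV (lt0r_neq0 p0)) powRrM.
  by rewrite gt0_ltr_powR ?invr_gt0 ?nnegrE ?powR_ge0 ?(ltW s0)// ltrDl.
apply: (le_trans (yt _ xs)); rewrite sK mulrDr lerD2l mulrCA.
by rewrite ler_piMr ?(ltW e0)// ler_pdivrMr// mul1r lerDl.
Qed.

(* Either [d] dominates [c * x ^+ 2], or the bound reads
   [x <= const * x `^ (2 * m)] with [2 * m > 1], which forces [x = 0] when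
   [x] is small. *)
Lemma absorb_quadratic (R : realType) (m a c : R) :
  1 / 2 < m -> 0 <= a -> 0 <= c ->
  exists2 eps, 0 < eps & forall x d : R, 0 <= x -> x <= eps -> 0 <= d ->
    x <= a * (d + c * x ^+ 2) `^ m -> x <= a * 2 `^ m * d `^ m.
Proof.
move=> m_gt a0 c0.
have m0 : 0 < m by lra.
have q0 : 0 < 2 * m - 1 by lra.
(* The radius below has power [2 * m - 1] equal to [b^-1]. The added 1 keeps [b] positive and gives
   the factor [(b - 1) / b < 1] that contradicts [x > 0]. *)
pose b := a * (2 * c) `^ m + 1.
have b0 : 0 < b by rewrite /b ltr_wpDl// mulr_ge0 ?powR_ge0.
exists ((b^-1) `^ (2 * m - 1)^-1); first by rewrite powR_gt0 ?invr_gt0.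
move=> x d x0 xe d0 xle.
have [dge|dlt] := leP (c * x ^+ 2) d.
  apply: (le_trans xle); rewrite -mulrA ler_wpM2l// -powRM//.
  rewrite ge0_ler_powR ?(ltW m0)// ?nnegrE.
  - by rewrite addr_ge0// mulr_ge0// sqr_ge0.
  - by rewrite mulr_ge0.
  - by rewrite mulr_natl mulr2n lerD2l.
have {}xle : x <= a * (2 * c) `^ m * x `^ (2 * m).
  apply: (le_trans xle); rewrite -mulrA ler_wpM2l// powRrM -powRM.
  - rewrite ge0_ler_powR ?(ltW m0)// ?nnegrE.
    + by rewrite addr_ge0// mulr_ge0// sqr_ge0.
    + by rewrite mulr_ge0 ?powR_ge0// mulr_ge0.
    + rewrite (powR_mulrn 2 x0); lra.
  - by rewrite mulr_ge0.
  - by rewrite powR_ge0.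
have [->|xn0] := eqVneq x 0; first by rewrite !mulr_ge0 ?powR_ge0.
have xgt0 : 0 < x by rewrite lt_def xn0.
have xb : x `^ (2 * m - 1) <= b^-1.
  rewrite -[leRHS](@powRr1 R) ?invr_ge0 ?(ltW b0)//.
  rewrite -[X in _ <= _ `^ X](mulVf (lt0r_neq0 q0)) powRrM.
  by rewrite ge0_ler_powR ?(ltW q0)// nnegrE ?powR_ge0.
suff: x < x by rewrite ltxx.
apply: (le_lt_trans xle).
have -> : x `^ (2 * m) = x * x `^ (2 * m - 1).
  by rewrite mulr_powRB1//; lra.
rewrite mulrCA gtr_pMr//.
apply: (@le_lt_trans _ _ ((b - 1) / b)).
  by rewrite /b addrK ler_wpM2l// mulr_ge0 ?powR_ge0.
by rewrite ltr_pdivrMr// mul1r ltrBlDr ltrDl.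
Qed.

(** * Bounds for continuous linear maps *)

Lemma banach_inclusion_continuous (R : realType) (X Y : completeNormedModType R)
  (i : {linear X -> Y}) : banach_inclusion i -> continuous i.
Proof.
move=> [_ [C C0 iC]]; apply/linear_bounded_continuous/linear_boundedP.
have := nbhs_pinfty_ge (num_real C); apply: filterS => r Cr x.
by apply: (le_trans (iC x)); rewrite ler_wpM2r.
Qed.

Lemma continuous_linear_bound (R : realType) (V W : normedModType R)
    (f : {linear V -> W}) : continuous f ->
  exists2 M, 0 < M & forall x, `|f x| <= M * `|x|.
Proof.
move=> /linear_bounded_continuous/linear_boundedP fb.
have /filterI/(_ fb)/filter_ex[M [M0 fM]] := nbhs_pinfty_gt (num_real (0 : R)).
by exists M.
Qed.

(** * Interpolation along sequences bounded in the smallest space *)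

Section interpolation.
Variables (R : realType) (X Y Z : completeNormedModType R).
Variables (i : {linear X -> Y}) (j : {linear Y -> Z}) (mu C : R).
Hypotheses (j_cont : continuous j) (mu_gt0 : 0 < mu) (mu_le1 : mu <= 1).
Hypotheses (C_gt0 : 0 < C).
Hypothesis ij_interp :
  forall u, `|i u| <= C * `|j (i u)| `^ mu * `|u| `^ (1 - mu).

Lemma interp_bounded u N : `|u| <= N ->
  `|i u| <= C * N `^ (1 - mu) * `|j (i u)| `^ mu.
Proof.
move=> uN; rewrite mulrAC; apply: (le_trans (ij_interp u)).
rewrite ler_wpM2l ?mulr_ge0 ?powR_ge0 ?(ltW C_gt0)//.
by rewrite ge0_ler_powR ?subr_ge0// nnegrE// (le_trans _ uN).
Qed.

(** The norm of [X] enters only through the bound [N], so the limit [y] need not come from [X]. *)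
Lemma interp_lim (u : X ^nat) N (y : Y) : (forall n, `|u n| <= N) ->
  i (u n) @[n --> \oo] --> y -> `|y| <= C * N `^ (1 - mu) * `|j y| `^ mu.
Proof.
move=> uN iuy; have a0 : 0 <= C * N `^ (1 - mu).
  by rewrite mulr_ge0 ?powR_ge0// ltW.
apply: ler_powR_lim => // t jyt.
have jiu : `|j (i (u n))| @[n --> \oo] --> `|j y|.
  by apply: cvg_norm; exact: (continuous_cvg _ (@j_cont y) iuy).
apply: (ler_cvg_to (cvg_norm iuy) (cvg_cst (C * N `^ (1 - mu) * t `^ mu))).
apply: filterS (cvgr_le _ jiu _ jyt) => n jt.
apply: (le_trans (interp_bounded (uN n))); rewrite ler_wpM2l//.
by rewrite ge0_ler_powR ?(ltW mu_gt0)// nnegrE// (le_trans _ jt).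
Qed.

(** Differences of terms of [u] are bounded by [N + N] in [X], so interpolation turns the Cauchy
    property in [Z] into the one in [Y], which is complete. *)
Lemma interp_lift (u : X ^nat) N (z : Z) : (forall n, `|u n| <= N) ->
  j (i (u n)) @[n --> \oo] --> z ->
  exists2 y, j y = z & i (u n) @[n --> \oo] --> y.
Proof.
move=> uN jiuz.
have a0 : 0 < C * (N + N) `^ (1 - mu) + 1.
  by rewrite ltr_wpDl// mulr_ge0 ?powR_ge0// ltW.
set a := _ + 1 in a0.
have : cvg (i (u n) @[n --> \oo]).
  apply: cauchy_cvg; apply/cauchy_ballP => e e0.
  (* Chosen so that [a] times the power [mu] of [d] is [e / 2]. *)
  pose d := (e / a / 2) `^ mu^-1.
  have d0 : 0 < d by rewrite powR_gt0// !divr_gt0.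
  have /cvg_cauchy/cauchy_ballP/(_ _ d0) : cvg (j (i (u n)) @[n --> \oo]).
    by apply/cvg_ex; exists z.
  rewrite !near_simpl.
  apply: filterS => -[n p] /=; rewrite -!ball_normE /= => jd.
  rewrite -linearB.
  have unp : `|u n - u p| <= N + N.
    by rewrite (le_trans (ler_normB _ _))// lerD.
  apply: (le_lt_trans (interp_bounded unp)).
  apply: (@le_lt_trans _ _ (a * d `^ mu)).
    rewrite ler_pM ?mulr_ge0 ?powR_ge0 ?(ltW C_gt0) ?/a ?lerDl//.
    by rewrite !linearB ge0_ler_powR ?(ltW mu_gt0) ?nnegrE ?(ltW d0) ?(ltW jd).
  rewrite /d -powRrM mulVf ?gt_eqF// powRr1 ?divr_ge0 ?(ltW e0) ?(ltW a0)//.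
  rewrite mulrCA mulrA mulfVK ?gt_eqF//; lra.
move=> /cvg_ex[y iuy]; exists y => //.
have jiuy : j (i (u n)) @[n --> \oo] --> j y.
  by exact: (continuous_cvg _ (@j_cont y) iuy).
exact: (norm_cvg_unique jiuy jiuz).
Qed.

End interpolation.

(** * Conditional stability of the linearization *)

Lemma le_linear_stability (R : realType)
    (B1 B1' B2 B2' : completeNormedModType R) (j1 : B1 -> B1') (i2 : B2' -> B2)
    (C D : R) (L : B1 -> B2) : C <= D ->
  linear_stability j1 i2 C L -> linear_stability j1 i2 D L.
Proof.
by move=> CD st h v /st hv; apply: (le_trans hv); rewrite ler_wpM2r.
Qed.

(* [h] need not lie in [B1'']: it is only a limit in [B1] of a sequence bounded
   in [B1''].  That [L h] still lies in [B2'] follows from the interpolation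
   estimate, which makes the images of the sequence Cauchy in [B2']. *)
Lemma linear_conditional_stability (R : realType)
    (B1 B1' B1'' B2 B2' B2'' : completeNormedModType R)
    (i1' : {linear B1 -> B1'}) (i1'' : {linear B1'' -> B1})
    (i2' : {linear B2' -> B2}) (i2'' : {linear B2'' -> B2'}) (mu1 mu2 C M : R) :
  continuous i1' -> continuous i2' ->
  0 < mu1 -> mu1 <= 1 -> 0 < mu2 -> mu2 <= 1 ->
  interpolation_estimate i2'' i2' mu2 -> interpolation_estimate i1'' i1' mu1 ->
  0 < C -> 0 < M ->
  exists2 a, 0 < a & forall (L : {linear B1 -> B2}) (T : {linear B1'' -> B2''}),
    continuous L -> linear_stability i1' i2' C L ->
    (forall h, `|T h| <= M * `|h|) -> restricts_to i1'' (i2' \o i2'') L T ->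
    forall (u : B1'' ^nat) (N : R) (h : B1), 0 < N -> (forall n, `|u n| <= N) ->
      i1'' (u n) @[n --> \oo] --> h ->
      `|h| <= a * N `^ (1 - mu1 * mu2) * `|L h| `^ (mu1 * mu2).
Proof.
move=> i1'c i2'c mu1_gt0 mu1_le1 mu2_gt0 mu2_le1 [C2 C2_gt0 int2].
move=> [C1 C1_gt0 int1] C0 M0.
exists (C1 * (C * (C2 * M `^ (1 - mu2))) `^ mu1).
  by rewrite mulr_gt0 ?powR_gt0// !mulr_gt0 ?powR_gt0.
move=> L T Lc st TM LT u N h N0 uN uh.
have TuN n : `|(T \o u) n| <= M * N.
  by apply: (le_trans (TM _)); rewrite ler_pM2l.
have TuL : i2' (i2'' ((T \o u) n)) @[n --> \oo] --> L h.
  rewrite (_ : (fun n => _) = (fun n => L (i1'' (u n)))).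
    exact: (continuous_cvg _ (@Lc h) uh).
  by apply/funext => n; exact: LT.
have [v vL iTuv] := interp_lift i2'c mu2_gt0 mu2_le1 C2_gt0 int2 TuN TuL.
have hle := interp_lim i1'c mu1_gt0 mu1_le1 C1_gt0 int1 uN uh.
have vle := interp_lim i2'c mu2_gt0 mu2_le1 C2_gt0 int2 TuN iTuv.
have {}st := st h v vL.
apply: (le_trans hle).
(* The first factor comes from interpolation in the domain, the second from interpolation in the
   range, raised to [mu1] by the former. *)
have -> : N `^ (1 - mu1 * mu2) = N `^ (1 - mu1) * N `^ ((1 - mu2) * mu1).
  by rewrite -powRD ?(gt_eqF N0) ?implybT//; congr (_ `^ _); ring.
rewrite (mulrC mu1) !powRrM.
set P := N `^ (1 - mu1); set Q := N `^ (1 - mu2); set S := `|L h| `^ mu2.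
set E := C * (C2 * M `^ (1 - mu2)).
have E_ge0 : 0 <= E by rewrite !mulr_ge0 ?powR_ge0 ?ltW.
have -> : C1 * E `^ mu1 * (P * Q `^ mu1) * S `^ mu1 =
    C1 * P * (E * (Q * S)) `^ mu1.
  have QS_ge0 : 0 <= Q * S by rewrite mulr_ge0 ?powR_ge0.
  rewrite (powRM _ E_ge0 QS_ge0) [(Q * S) `^ _]powRM ?powR_ge0//.
  by move: (E `^ _) (Q `^ _) (S `^ _) => *; ring.
rewrite ler_wpM2l ?mulr_ge0 ?powR_ge0 ?(ltW C1_gt0)//.
have CvS : `|i1' h| <= E * (Q * S).
  apply: (le_trans st); rewrite /E -mulrA ler_pM2l//; apply: (le_trans vle).
  by rewrite vL powRM ?(ltW M0) ?(ltW N0)// !mulrA.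
by rewrite ge0_ler_powR ?(ltW mu1_gt0)// nnegrE// (le_trans _ CvS).
Qed.

(** * From the differential back to [A] *)

Lemma differential_le (R : realType) (X Y : completeNormedModType R)
    (A : X -> Y) (f g : X) (C : R) : `|remainder A f g| <= C * `|g - f| ^+ 2 ->
  `|'d A f (g - f)| <= `|A g - A f| + C * `|g - f| ^+ 2.
Proof.
move=> rC; have -> : 'd A f (g - f) = (A g - A f) - remainder A f g.
  by rewrite /remainder opprB !addrA subrK [A g + _]addrC addrK.
by rewrite (le_trans (ler_normB _ _))// lerD2l.
Qed.

Lemma eq_of_stability (R : realType) (X Y : completeNormedModType R)
    (A : X -> Y) (f g : X) (b m : R) : m != 0 ->
  `|f - g| <= b * `|A f - A g| `^ m -> A f = A g -> f = g.
Proof.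
move=> m0 + Afg; rewrite Afg subrr normr0 powR0// mulr0 normr_le0 subr_eq0.
by move/eqP.
Qed.

Theorem theorem2 (R : realType)
    (B1 B1' B1'' B2 B2' B2'' : completeNormedModType R)
    (* B1'' ⊂ B1 ⊂ B1'  and  B2'' ⊂ B2' ⊂ B2 *)
    (i1' : {linear B1 -> B1'}) (i1'' : {linear B1'' -> B1})
    (i2' : {linear B2' -> B2}) (i2'' : {linear B2'' -> B2'})
    (hi1' : banach_inclusion i1') (hi1'' : banach_inclusion i1'')
    (hi2' : banach_inclusion i2') (hi2'' : banach_inclusion i2'')
    (A : B1 -> B2) (A_cont : continuous A) (f0 : B1)
    (* (i) *)
    (A_diff : differentiable A f0)
    (A_remainder : exists C : R,
      \forall f \near f0, `|remainder A f0 f| <= C * `|f - f0| ^+ 2)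
    (* (ii) *)
    (A_stab : exists C : R, linear_stability i1' i2' C ('d A f0))
    (A_restr : exists2 T : {linear B1'' -> B2''},
      continuous T & restricts_to i1'' (i2' \o i2'') ('d A f0) T)
    (mu1 mu2 : R)
    (mu1_gt0 : 0 < mu1) (mu1_le1 : mu1 <= 1)
    (mu2_gt0 : 0 < mu2) (mu2_le1 : mu2 <= 1)
    (mu12 : 1 / 2 < mu1 * mu2)
    (interp2 : interpolation_estimate i2'' i2' mu2)
    (interp1 : interpolation_estimate i1'' i1' mu1) :
  (* (a) *)
  (forall K0 : R, 0 < K0 -> exists2 C : R, 0 < C &
    forall K : R, K0 <= K -> exists2 eps : R, 0 < eps &
      forall f : B1'', `|i1'' f - f0| <= eps -> `|f| <= K ->
        `|i1'' f - f0| <=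
          C * K `^ (2 - mu1 - mu2) * `|A (i1'' f) - A f0| `^ (mu1 * mu2) /\
        (A (i1'' f) = A f0 -> i1'' f = f0)) /\
  (* (b) *)
  (forall (KK : completeNormedModType R) (iK : {linear KK -> B1''}),
    banach_inclusion iK ->
    (exists r C M : R, 0 < r /\
      (forall f : B1, close_in (i1'' \o iK) f0 r f ->
        [/\ differentiable A f,
            linear_stability i1' i2' C ('d A f) &
            exists2 T : {linear B1'' -> B2''},
              forall h : B1'', `|T h| <= M * `|h| &
              restricts_to i1'' (i2' \o i2'') ('d A f) T]) /\
      (* (i) with f0 replaced by f, uniformly *)
      (forall f g : B1,
        close_in (i1'' \o iK) f0 r f -> close_in (i1'' \o iK) f0 r g ->
        `|remainder A f g| <= C * `|g - f| ^+ 2)) ->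
    exists eps C : R, [/\ 0 < eps, 0 < C &
      forall f1 f2 : B1,
        close_in (i1'' \o iK) f0 eps f1 -> close_in (i1'' \o iK) f0 eps f2 ->
        `|f1 - f2| <= C * `|A f1 - A f2| `^ (mu1 * mu2) /\
        (A f1 = A f2 -> f1 = f2)]).
Proof.
have i1'c := banach_inclusion_continuous hi1'.
have i2'c := banach_inclusion_continuous hi2'.
have i1''c := banach_inclusion_continuous hi1''.
have lin := @linear_conditional_stability _ _ _ _ _ _ _ i1' i1'' i2' i2'' mu1
  mu2 _ _ i1'c i2'c mu1_gt0 mu1_le1 mu2_gt0 mu2_le1 interp2 interp1.
have m_neq0 : mu1 * mu2 != 0 by rewrite mulf_neq0 ?gt_eqF.
split.

(* Stability around the fixed point [f0] *)
- move=> K0 K0_gt0; have [C /le_linear_stability A_st] := A_stab.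
  have [T T_cont LT] := A_restr.
  have [M M_gt0 TM] := continuous_linear_bound T_cont.
  have C_gt0 : 0 < `|C| + 1 by rewrite ltr_wpDl.
  have {}A_st := A_st _ (ler_wpDr ler01 (ler_norm C)).
  have [a a_gt0 {}lin] := lin _ _ C_gt0 M_gt0.
  have {}lin := lin _ T (diff_continuous A_diff) A_st TM LT.
  pose q := (1 - mu1) * (1 - mu2).
  have q_ge0 : 0 <= q by rewrite mulr_ge0 ?subr_ge0.
  (* The 2 collects the powers of 2 from [K + K] and from the absorption; the last factor bounds the
     inverse of the power [q] of [K]. *)
  exists (2 * a * (K0 `^ q)^-1).
    by rewrite !mulr_gt0 ?invr_gt0 ?powR_gt0.
  move=> K K0K; have K_gt0 : 0 < K := lt_le_trans K0_gt0 K0K.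
  pose near_f0 n k := `|k| <= K /\ `|i1'' k - f0| <= n.+1%:R^-1.
  (* If [f0] is not in the closure in [B1] of the [K]-ball of [B1''], then no
     [f] satisfies the constraints once [eps] is small. *)
  have [no_near|] := pselect (exists n, forall k, ~ near_f0 n k).
    have [n nf] := no_near; exists n.+1%:R^-1; first by rewrite invr_gt0.
    by move=> f fe fK; case: (nf f).
  move=> /forallNP ex_near.
  have {ex_near} [u u_near] : {u : B1'' ^nat & forall n, near_f0 n (u n)}.
    by apply: choice => n; have /existsNP[k /contrapT kn] := ex_near n; exists k.
  have uf0 : i1'' (u n) @[n --> \oo] --> f0.
    apply/cvgrPdist_le => e e_gt0.
    have := near_infty_natSinv_lt (PosNum e_gt0); apply: filterS => n ne.
    by rewrite distrC (le_trans (u_near n).2)// ltW.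
  have [C' Crem] := A_remainder.
  have /nbhs_ballP[e /= e_gt0 fe] := Crem.
  (* The differences [f - u n] are bounded by [K + K] in [B1''] and tend to [f - f0] in [B1]. *)
  have KK_gt0 : 0 < K + K by rewrite addr_gt0.
  pose b := a * (K + K) `^ (1 - mu1 * mu2).
  have b_ge0 : 0 <= b by rewrite mulr_ge0 ?powR_ge0 ?(ltW a_gt0).
  have [eps eps_gt0 absorb] := absorb_quadratic mu12 b_ge0 (normr_ge0 C').
  (* Halving [e] puts the closed bound inside the open ball where (i) holds. *)
  exists (Num.min eps (e / 2)); first by rewrite lt_min eps_gt0 divr_gt0.
  move=> f; rewrite le_min => /andP[feps fe2] fK.
  have rem : `|remainder A f0 (i1'' f)| <= `|C'| * `|i1'' f - f0| ^+ 2.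
    apply: (@le_trans _ _ (C' * `|i1'' f - f0| ^+ 2)).
      apply: fe; rewrite -ball_normE /= distrC (le_lt_trans fe2)//.
      by rewrite ltr_pdivrMr// ltr_pMr// ltr1n.
    by rewrite ler_wpM2r ?exprn_ge0// ler_norm.
  have uN n : `|f - u n| <= K + K.
    by rewrite (le_trans (ler_normB _ _))// lerD//; case: (u_near n).
  have ufh : i1'' (f - u n) @[n --> \oo] --> i1'' f - f0.
    rewrite (_ : (fun n => _) = (fun n => i1'' f - i1'' (u n))).
      by apply: cvgB => //; exact: cvg_cst.
    by apply/funext => n; rewrite linearB.
  have := lin _ _ _ KK_gt0 uN ufh; rewrite -/b => hle.
  have {}hle : `|i1'' f - f0| <= b * 2 `^ (mu1 * mu2) *
      `|A (i1'' f) - A f0| `^ (mu1 * mu2).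
    apply: absorb => //; apply: (le_trans hle); rewrite ler_wpM2l//.
    have dle := differential_le rem.
    rewrite ge0_ler_powR ?nnegrE// ?(le_trans _ dle)//.
    by rewrite mulr_ge0 ?(ltW mu1_gt0) ?(ltW mu2_gt0).
  split; last exact: (eq_of_stability m_neq0 hle).
  apply: (le_trans hle); rewrite ler_wpM2r ?powR_ge0//.
  have -> : b = a * (K * 2) `^ (1 - mu1 * mu2) by rewrite mulr_natr mulr2n.
  rewrite powRM ?(ltW K_gt0)//.
  have -> : a * (K `^ (1 - mu1 * mu2) * 2 `^ (1 - mu1 * mu2)) *
      2 `^ (mu1 * mu2) = 2 * a * K `^ (1 - mu1 * mu2).
    have VW : (2 : R) `^ (1 - mu1 * mu2) * 2 `^ (mu1 * mu2) = 2.
      by rewrite -powRD ?pnatr_eq0 ?implybT// subrK powRr1.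
    rewrite -[X in _ = X * a * _]VW.
    by move: (_ `^ _) (_ `^ _) (_ `^ _) => *; ring.
  have -> : K `^ (1 - mu1 * mu2) = (K `^ q)^-1 * K `^ (2 - mu1 - mu2).
    rewrite -powRN -powRD ?(gt_eqF K_gt0) ?implybT//; congr (_ `^ _).
    rewrite /q; ring.
  rewrite mulrA ler_wpM2r ?powR_ge0// ler_wpM2l ?mulr_ge0 ?(ltW a_gt0)//.
  rewrite lef_pV2 ?posrE ?powR_gt0// ge0_ler_powR ?nnegrE ?(ltW K0_gt0)//.
  exact: ltW.

(* Stability between two points close to [f0] *)
- move=> KK iK [_ [cK cK_gt0 iK_le]] [r [C [M [r_gt0 [dA rem]]]]].
  have C_gt0 : 0 < `|C| + 1 by rewrite ltr_wpDl.
  have M_gt0 : 0 < `|M| + 1 by rewrite ltr_wpDl.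
  have [a a_gt0 {}lin] := lin _ _ C_gt0 M_gt0.
  have [_ [c1 c1_gt0 i1''_le]] := hi1''.
  pose N := cK * 2.
  have N_gt0 : 0 < N by rewrite mulr_gt0.
  pose b := a * N `^ (1 - mu1 * mu2).
  have b_gt0 : 0 < b by rewrite mulr_gt0 ?powR_gt0.
  have [eps eps_gt0 absorb] :=
    absorb_quadratic mu12 (ltW b_gt0) (normr_ge0 C).
  have cN_gt0 : 0 < c1 * N by rewrite mulr_gt0.
  (* In turn: the hypotheses apply at [f1] and [f2], their difference has [B1'']-norm at most [N],
     and its [B1]-norm is at most [eps]. *)
  pose del := Num.min r (Num.min 1 (eps / (c1 * N))).
  have del_r : del <= r by rewrite ge_min lexx.
  have del_1 : del <= 1 by rewrite !ge_min lexx orbT.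
  have del_eps : del <= eps / (c1 * N) by rewrite !ge_min lexx !orbT.
  exists del, (b * 2 `^ (mu1 * mu2)); split.
  + by rewrite !lt_min r_gt0 ltr01 divr_gt0.
  + by rewrite mulr_gt0 ?powR_gt0.
  move=> f1 f2 [k1 /= fk1 k1_le] [k2 /= fk2 k2_le].
  have f1_r : close_in (i1'' \o iK) f0 r f1.
    by exists k1; rewrite // (le_trans k1_le).
  have f2_r : close_in (i1'' \o iK) f0 r f2.
    by exists k2; rewrite // (le_trans k2_le).
  have [A_diff1 /le_linear_stability A_st [T TM LT]] := dA _ f1_r.
  have {}A_st := A_st _ (ler_wpDr ler01 (ler_norm C)).
  have {}TM h : `|T h| <= (`|M| + 1) * `|h|.
    by rewrite (le_trans (TM h))// ler_wpM2r// ler_wpDr// ler_norm.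
  have {}rem : `|remainder A f1 f2| <= `|C| * `|f2 - f1| ^+ 2.
    by rewrite (le_trans (rem _ _ f1_r f2_r))// ler_wpM2r ?exprn_ge0// ler_norm.
  have fE : f2 - f1 = i1'' (iK (k2 - k1)).
    by rewrite !linearB -fk1 -fk2 opprB addrA subrK.
  have kN : `|iK (k2 - k1)| <= N * del.
    rewrite (le_trans (iK_le _))// /N -mulrA ler_pM2l//.
    by rewrite (le_trans (ler_normB _ _))// mulr_natl mulr2n lerD.
  have kN1 : `|iK (k2 - k1)| <= N.
    by rewrite (le_trans kN)// ger_pMr.
  have f_eps : `|f2 - f1| <= eps.
    rewrite fE (le_trans (i1''_le _))//.
    apply: (@le_trans _ _ (c1 * (N * del))); first by rewrite ler_pM2l.
    by rewrite mulrA mulrC -ler_pdivlMr.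
  (* The linearization is at [f1]. As [f0] cancels, [f2 - f1] lies in [B1''] and a constant sequence
     suffices. *)
  have hle := lin _ T (diff_continuous A_diff1) A_st TM LT
    (fun=> iK (k2 - k1)) N (f2 - f1) N_gt0 (fun=> kN1).
  have {}hle :
      `|f2 - f1| <= b * 2 `^ (mu1 * mu2) * `|A f2 - A f1| `^ (mu1 * mu2).
    apply: absorb => //; apply: (le_trans (hle _)).
      by rewrite fE; exact: cvg_cst.
    rewrite ler_wpM2l ?(ltW b_gt0)//.
    have dle := differential_le rem.
    rewrite ge0_ler_powR ?nnegrE// ?(le_trans _ dle)//.
    by rewrite mulr_ge0 ?(ltW mu1_gt0) ?(ltW mu2_gt0).
  split; first by rewrite distrC [`|A f1 - _|]distrC.
  by move=> /esym /(eq_of_stability m_neq0 hle)/esym.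
Qed.
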